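(* Let $K$ be a field of characteristic $p$ (a prime) and let $G$ be a finite group with a normal $p$-complement. If $S$ is a simple $KG$-module with $\operatorname{Ext}^1_{KG}(S,S)\neq 0$, then $\operatorname{Ext}^n_{KG}(S,S)\neq 0$ for all $n\geq 1$.
   Context: A finite group $G$ has a normal $p$-complement for a prime $p$ if $G$ is the semidirect product of a normal subgroup $H$ of order coprime to $p$ and a Sylow $p$-subgroup of $G$. *)

(* Defs.v *)
From HB Require Import structures.
From mathcomp Require Import all_boot all_algebra all_fingroup all_solvable.
From mathcomp Require Import boolp functions.
From mathcomp Require Import ring_quotient.
From mathcomp.multinomials Require Import monalg.

Set Implicit Arguments.
Unset Strict Implicit.
Unset Printing Implicit Defensive.

Import GRing.Theory.
Local Open Scope ring_scope.

(* The group algebra K[gT]; {malg K[gT]} is not available, since a monomType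
   has no nontrivial units. *)
Definition group_algebra (K : nzRingType) (gT : finGroupType) : Type :=
  {ffun gT -> K}.

Section GroupAlgebra.
Variables (K : nzRingType) (gT : finGroupType).
Local Notation KG := (group_algebra K gT).

HB.instance Definition _ := GRing.Zmodule.copy KG {ffun gT -> K}.

Definition gralg_one : KG := [ffun g => (g == 1%g)%:R].
Definition gralg_mul (a b : KG) : KG :=
  [ffun g => \sum_(h : gT) a h * b (h^-1 * g)%g].

Fact gralg_mulA : associative gralg_mul.
Proof.
move=> a b c; apply/ffunP=> g; rewrite !ffunE.
transitivity (\sum_h \sum_k a h * b (h^-1 * k)%g * c (k^-1 * g)%g).
  apply: eq_bigr => h _; rewrite ffunE mulr_sumr.
  rewrite [RHS](reindex_inj (mulgI h)) /=.
  apply: eq_bigr => k _.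
  by rewrite mulKg invMg mulgA mulrA.
rewrite exchange_big /=; apply: eq_bigr => k _.
by rewrite ffunE mulr_suml.
Qed.

Fact gralg_mul1r : left_id gralg_one gralg_mul.
Proof.
move=> a; apply/ffunP=> g; rewrite ffunE (bigD1 1%g) //= ffunE eqxx mul1r.
rewrite invg1 mul1g big1 ?addr0 // => h /negbTE h1.
by rewrite ffunE h1 mul0r.
Qed.

Fact gralg_mulr1 : right_id gralg_one gralg_mul.
Proof.
move=> a; apply/ffunP=> g; rewrite ffunE (bigD1 g) //= ffunE mulVg eqxx mulr1.
rewrite big1 ?addr0 // => h hg; rewrite ffunE.
by rewrite -eq_mulVg1 (negbTE hg) mulr0.
Qed.

Fact gralg_mulDl : left_distributive gralg_mul +%R.
Proof.
move=> a b c; apply/ffunP=> g; rewrite !ffunE -big_split /=.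
by apply: eq_bigr => h _; rewrite ffunE mulrDl.
Qed.

Fact gralg_mulDr : right_distributive gralg_mul +%R.
Proof.
move=> a b c; apply/ffunP=> g; rewrite !ffunE -big_split /=.
by apply: eq_bigr => h _; rewrite ffunE mulrDr.
Qed.

Fact gralg_one_neq0 : gralg_one != 0.
Proof.
by apply/eqP=> /ffunP/(_ 1%g)/eqP; rewrite !ffunE eqxx oner_eq0.
Qed.

HB.instance Definition _ := GRing.Zmodule_isNzRing.Build KG
  gralg_mulA gralg_mul1r gralg_mulr1 gralg_mulDl gralg_mulDr gralg_one_neq0.

End GroupAlgebra.

Definition has_normal_p_complement (p : nat) (gT : finGroupType)
    (G : {group gT}) : Prop :=
  exists H P : {group gT},
    [/\ H <| G, coprime #|H| p, p.-Sylow(G) P & H ><| P = G]%g.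

Definition simple_module (R : nzRingType) (S : lmodType R) : Prop :=
  (exists x : S, x != 0) /\
  forall U : {pred S}, submod_closed U ->
    (forall x, x \in U -> x = 0) \/ (forall x, x \in U).

Definition projective_module (R : nzRingType) (P : lmodType R) : Prop :=
  forall (U V : lmodType R) (g : {linear U -> V}) (f : {linear P -> V}),
    (forall v, exists u, g u = v) ->
    exists h : {linear P -> U}, forall x, g (h x) = f x.

Record projective_resolution (R : nzRingType) (M : lmodType R) :=
  ProjectiveResolution {
    pr_obj : nat -> lmodType R;
    pr_aug : {linear pr_obj 0 -> M};
    pr_diff : forall n, {linear pr_obj n.+1 -> pr_obj n};
    pr_projective : forall n, projective_module (pr_obj n);
    pr_aug_surj : forall x, exists y, pr_aug y = x;
    pr_exact0 : forall x, pr_aug x = 0 <-> exists y, pr_diff 0 y = x;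
    pr_exactS : forall n x, pr_diff n x = 0 <-> exists y, pr_diff n.+1 y = x
  }.

Section ModHom.
Variables (R : nzRingType) (U V : lmodType R).

Definition linear_pred : {pred U -> V} := fun f => `[< linear f >].

Fact linear_pred_zmod : zmod_closed linear_pred.
Proof.
split.
  by apply/asboolP=> a u v; rewrite -[RHS]/(a *: 0 + 0 : V) scaler0 addr0.
move=> f g /asboolP lf /asboolP lg; apply/asboolP=> a u v.
rewrite -[LHS]/(f (a *: u + v) - g (a *: u + v)).
rewrite -[RHS]/(a *: (f u - g u) + (f v - g v)).
by rewrite lf lg scalerBr opprD addrACA.
Qed.
HB.instance Definition _ :=
  GRing.isZmodClosed.Build (U -> V) linear_pred linear_pred_zmod.

Record mod_hom := ModHomOf { hom_val :> U -> V; _ : hom_val \in linear_pred }.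
HB.instance Definition _ := [isSub for hom_val].
HB.instance Definition _ := [Choice of mod_hom by <:].
HB.instance Definition _ := [SubChoice_isSubZmodule of mod_hom by <:].

Lemma hom_linear (f : mod_hom) : linear f.
Proof. by apply/asboolP; case: f. Qed.
HB.instance Definition _ (f : mod_hom) :=
  GRing.isLinear.Build R U V *:%R (hom_val f) (hom_linear f).

End ModHom.

Section HomPrecomp.
Variables (R : nzRingType) (U U' V : lmodType R) (d : {linear U' -> U}).

Fact hom_precomp_subproof (f : mod_hom U V) : (f \o d) \in @linear_pred R U' V.
Proof. by apply/asboolP=> a u v /=; rewrite !linearP. Qed.
Definition hom_precomp (f : mod_hom U V) : mod_hom U' V :=
  ModHomOf (hom_precomp_subproof f).

Fact hom_precomp_zmod : zmod_morphism hom_precomp.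
Proof. by move=> f g; apply: val_inj. Qed.
HB.instance Definition _ :=
  GRing.isZmodMorphism.Build (mod_hom U V) (mod_hom U' V) hom_precomp hom_precomp_zmod.

End HomPrecomp.

Section Homology.
Variables (A B C : zmodType) (f : {additive A -> B}) (g : {additive B -> C}).

Definition cycle_pred : {pred B} := [pred x | g x == 0].
Fact cycle_pred_zmod : zmod_closed cycle_pred.
Proof.
split=> [|x y]; rewrite !inE ?raddf0 // => /eqP gx /eqP gy.
by rewrite raddfB gx gy subr0.
Qed.
HB.instance Definition _ :=
  GRing.isZmodClosed.Build B cycle_pred cycle_pred_zmod.

Record cycles := CycleOf { cycle_val :> B; _ : cycle_val \in cycle_pred }.
HB.instance Definition _ := [isSub for cycle_val].
HB.instance Definition _ := [Choice of cycles by <:].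
HB.instance Definition _ := [SubChoice_isSubZmodule of cycles by <:].

Definition boundary_pred : {pred cycles} :=
  fun z => `[< exists a, f a = cycle_val z >].
Fact boundary_pred_zmod : zmod_closed boundary_pred.
Proof.
split; first by apply/asboolP; exists 0; rewrite raddf0.
move=> x y /asboolP[a fa] /asboolP[b fb]; apply/asboolP; exists (a - b).
by rewrite raddfB fa fb.
Qed.
HB.instance Definition _ :=
  GRing.isZmodClosed.Build cycles boundary_pred boundary_pred_zmod.

(* ker g / (im f :&: ker g), which is ker g / im f when g \o f = 0 *)
Definition homology : zmodType := Quotient.quot boundary_pred.

End Homology.
Arguments boundary_pred {A B C} f g.

Section ExtOf.
Variables (R : nzRingType) (M N : lmodType R) (P : projective_resolution M).

Definition hom_diff (n : nat) :
    {additive mod_hom (pr_obj P n) N -> mod_hom (pr_obj P n.+1) N} :=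
  hom_precomp (pr_diff P n).

(* the differential entering degree n of Hom(P, N); it is 0 for n = 0 *)
Definition hom_diff_in (n : nat) :
    {additive mod_hom (pr_obj P n.-1) N -> mod_hom (pr_obj P n) N} :=
  match n with
  | 0 => \0
  | m.+1 => hom_diff m
  end.

Definition Ext_of (n : nat) : zmodType :=
  homology (hom_diff_in n) (hom_diff n).

End ExtOf.

Section Kernel.
Variables (R : nzRingType) (U V : lmodType R) (f : {linear U -> V}).

Definition kernel_pred : {pred U} := [pred x | f x == 0].
Fact kernel_pred_submod : submod_closed kernel_pred.
Proof.
split=> [|a x y]; rewrite !inE ?linear0 // => /eqP fx /eqP fy.
by rewrite linearP fx fy scaler0 addr0.
Qed.
HB.instance Definition _ :=
  GRing.isSubmodClosed.Build R U kernel_pred kernel_pred_submod.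

Record kernel := KernelOf { kernel_val :> U; _ : kernel_val \in kernel_pred }.
HB.instance Definition _ := [isSub for kernel_val].
HB.instance Definition _ := [Choice of kernel by <:].
HB.instance Definition _ := [SubChoice_isSubLmodule of kernel by <:].

Lemma kernelP (x : kernel) : f (kernel_val x) = 0.
Proof. by case: x => x /= /eqP. Qed.

End Kernel.

Section FreeModule.
Variables (R : nzRingType) (X : choiceType) (V : lmodType R) (e : X -> V).

Definition free_lift (x : {malg R[X]}) : V :=
  \sum_(k <- finmap.enum_fset (msupp x)) x@_k *: e k.

Lemma free_lift_wide (d : finmap.finset_of (Phant X)) (x : {malg R[X]}) :
  finmap.fsubset (msupp x) d ->
  free_lift x = \sum_(k <- finmap.enum_fset d) x@_k *: e k.
Proof.
move=> sxd; rewrite /free_lift (finmap.big_fset_incl _ sxd) //= => k kd kx.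
by rewrite mcoeff_outdom // scale0r.
Qed.

Fact free_lift_linear : linear free_lift.
Proof.
move=> a x y; pose d := finmap.fsetU (msupp (a *: x + y))
  (finmap.fsetU (msupp x) (msupp y)).
rewrite !(@free_lift_wide d); last first.
- exact: finmap.fsubsetUl.
- exact: finmap.fsubset_trans (finmap.fsubsetUl _ _) (finmap.fsubsetUr _ _).
- exact: finmap.fsubset_trans (finmap.fsubsetUr _ _) (finmap.fsubsetUr _ _).
rewrite scaler_sumr -big_split /=; apply: eq_bigr => k _.
by rewrite mcoeffD mcoeffZ scalerDl scalerA.
Qed.
HB.instance Definition _ :=
  GRing.isLinear.Build R {malg R[X]} V *:%R free_lift free_lift_linear.

Lemma free_liftU k : free_lift (mkmalgU k 1) = e k.
Proof.
rewrite (@free_lift_wide (finmap.fset1 k)) ?msuppU_le //.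
by rewrite finmap.big_seq_fset1 mcoeffU eqxx scale1r.
Qed.

End FreeModule.

Lemma free_lift_unique (R : nzRingType) (X : choiceType) (V : lmodType R)
    (f : {linear {malg R[X]} -> V}) x :
  f x = free_lift (fun k => f (mkmalgU k 1)) x.
Proof.
rewrite {1}[x]monalgE linear_sum /free_lift; apply: eq_bigr => k _.
rewrite -linearZ; congr (f _); apply/malgP=> l.
by rewrite mcoeffZ !mcoeffU mulr_natr.
Qed.

Lemma free_projective (R : nzRingType) (X : choiceType) :
  projective_module {malg R[X]}.
Proof.
move=> U V g f gsurj.
pose e k := projT1 (cid (gsurj (f (mkmalgU k 1)))).
exists (free_lift e) => x.
rewrite [RHS]free_lift_unique /free_lift linear_sum.
by apply: eq_bigr => k _; rewrite linearZ /e; case: cid => u /= ->.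
Qed.

Section FreeResolution.
Variable R : nzRingType.

Definition free_cover (M : lmodType R) : {linear {malg R[M]} -> M} :=
  free_lift (fun x : M => x).

Definition syzygy (M : lmodType R) : lmodType R := kernel (free_cover M).

Variable M : lmodType R.

Definition free_obj (n : nat) : lmodType R := {malg R[iter n syzygy M]}.

(* free_obj n.+1 ->> iter n.+1 syzygy M, the kernel of
   free_cover (iter n syzygy M), included in free_obj n *)
Definition free_diff (n : nat) : {linear free_obj n.+1 -> free_obj n} :=
  val \o free_cover (syzygy (iter n syzygy M)).

Lemma free_cover_surj (N : lmodType R) (x : N) : exists y, free_cover N y = x.
Proof. by exists (mkmalgU x 1); rewrite /free_cover /= free_liftU. Qed.

Lemma free_cover_exact n x :
  free_cover (iter n syzygy M) x = 0 <-> exists y, free_diff n y = x.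
Proof.
split=> [fx|[y <-]]; last by rewrite /free_diff /= kernelP.
have xK : x \in kernel_pred (free_cover (iter n syzygy M)).
  by rewrite inE fx.
have [y yE] := free_cover_surj (KernelOf xK : syzygy (iter n syzygy M)).
by exists y; rewrite /free_diff /= yE.
Qed.

Lemma free_diff_exact n x :
  free_diff n x = 0 <-> exists y, free_diff n.+1 y = x.
Proof.
rewrite -free_cover_exact /free_diff /=; split=> [|->]; last by [].
by move=> h; apply: val_inj.
Qed.

Definition free_resolution : projective_resolution M :=
  @ProjectiveResolution R M free_obj (free_cover M) free_diff
    (fun n => @free_projective R (iter n syzygy M))
    (@free_cover_surj M) (@free_cover_exact 0) (@free_diff_exact).

End FreeResolution.

(* Any projective resolution of M gives the same groups up to isomorphism;
   free_resolution fixes a choice. *)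
Definition Ext (R : nzRingType) (n : nat) (M N : lmodType R) : zmodType :=
  Ext_of N (free_resolution M) n.

(* Main.v *)
Require Import Defs.
From HB Require Import structures.
From mathcomp Require Import all_boot all_algebra all_fingroup all_solvable.
From mathcomp Require Import boolp classical_sets functions ring_quotient.

Set Implicit Arguments.
Unset Strict Implicit.
Unset Printing Implicit Defensive.

Import GRing.Theory.
Local Open Scope ring_scope.
Local Open Scope quotient_scope.

(** Write [G = HQ] with [H] the normal [p]-complement and [Q] a [p]-group. The
    block of [S] has [S] as its only simple module: if [U] is a nonzero module in
    the block, then [S] and [U] share a constituent over [H], so the space of
    [KH]-linear maps from [U] to [S] is nonzero; the [p]-group [Q] acts on this
    space of characteristic [p] by conjugation, hence has a nonzero fixed point
    there, which is a [KG]-linear map from [U] to [S] ([block_map]). An induction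
    on the dimension then shows that vanishing of [Ext^n(S, S)] forces vanishing
    of [Ext^n(S, U)] for all finite-dimensional [U] in the block
    ([ext_vanishes_block]).

    Since the group algebra is injective over itself ([ext_vanishes_regular]), so
    is its direct summand belonging to the block. This summand [B] maps onto [S]
    ([block_cover]), and dimension shifting along [0 -> U -> B -> S -> 0]
    identifies [Ext^n(S, S)] with [Ext^(n+1)(S, U)] for [n >= 1]. So if
    [Ext^(n+1)(S, S)] is zero then [Ext^n(S, S)] is zero
    ([ext_vanishes_pred]), and descending to degree one contradicts the
    hypothesis.

    Blocks are described without primitive idempotents: a module is in the
    block when it is killed by the elements of [KH] that kill [S]. Idempotents
    come from Maschke's theorem, in the form that a left ideal of [KH] has a right
    identity ([left_ideal_right_identity]). Both this and the injectivity of the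
    group algebra rest on the extension of [K]-linear maps from subspaces
    ([linear_extension]), which is done by Zorn's lemma since the terms of the
    free resolution need not be of finite dimension. *)

(** * Vanishing of Ext as an extension property *)

Section LinearMaps.
Variables (R : nzRingType) (U V : lmodType R).

Lemma pack_linear (f : U -> V) : linear f -> {g : {linear U -> V} | g =1 f}.
Proof.
move=> lf; pose g : {linear U -> V} := HB.pack f (GRing.isLinear.Build R U V *:%R f lf).
by exists g.
Qed.

End LinearMaps.

Lemma corestrict_kernel (R : nzRingType) (U V W : lmodType R)
    (phi : {linear V -> W}) (f : {linear U -> V}) :
  (forall u, phi (f u) = 0) ->
  exists g : {linear U -> kernel phi}, forall u, kernel_val (g u) = f u.
Proof.
move=> fK; have fP u : f u \in kernel_pred phi by rewrite inE fK eqxx.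
have lg : linear (fun u => KernelOf (fP u)).
  by move=> a u v; apply: val_inj; rewrite /= linearP.
by have [g gE] := pack_linear lg; exists g => u; rewrite gE.
Qed.

Lemma mod_hom_ext (R : nzRingType) (U V : lmodType R) (f g : mod_hom U V) :
  hom_val f =1 hom_val g -> f = g.
Proof. by move=> fg; apply: val_inj; apply/funext. Qed.

Section VanishingExt.
Variables (R : nzRingType) (M : lmodType R) (P : projective_resolution M).

(** Vanishing of Ext in degree [n.+1]; stating it in terms of maps out of the
    fixed resolution lets the second argument vary freely. *)
Definition ext_vanishes (n : nat) (N : lmodType R) : Prop :=
  forall f : {linear pr_obj P n.+1 -> N},
    (forall x, f (pr_diff P n.+1 x) = 0) ->
    exists g : {linear pr_obj P n -> N}, forall x, g (pr_diff P n x) = f x.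

Lemma Ext_eq0P n (N : lmodType R) :
  (forall x : Ext_of N P n.+1, x = 0) <-> ext_vanishes n N.
Proof.
have cycleE h : (h \in cycle_pred (hom_diff N P n.+1)) =
    (hom_diff N P n.+1 h == 0) by [].
split=> [E0 f fd | E0 x].
  have fL : (f : _ -> _) \in @linear_pred R (pr_obj P n.+1) N.
    by apply/asboolP=> a u v; rewrite linearP.
  have fC : ModHomOf fL \in cycle_pred (hom_diff N P n.+1).
    by rewrite cycleE; apply/eqP; apply: mod_hom_ext => x; apply: fd.
  pose z : cycles (hom_diff N P n.+1) := CycleOf fC.
  have /eqP := E0 (\pi_(Ext_of N P n.+1) z).
  have -> : 0 = \pi_(Ext_of N P n.+1) 0 :> Ext_of N P n.+1 by rewrite piE.
  rewrite -Quotient.idealrBE subr0 => /asboolP[g gE].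
  exists g => x.
  by have := congr1 (fun h : mod_hom _ _ => hom_val h x) gE.
elim/quotW: x => z.
have -> : 0 = \pi_(Ext_of N P n.+1) 0 :> Ext_of N P n.+1 by rewrite piE.
apply/eqP; rewrite -Quotient.idealrBE subr0.
have zd y : cycle_val z (pr_diff P n.+1 y) = 0.
  case: z => h /=; rewrite cycleE => /eqP hd.
  by have := congr1 (fun h : mod_hom _ _ => hom_val h y) hd.
have [g gE] := E0 (hom_val (cycle_val z)) zd.
have gL : (g : _ -> _) \in @linear_pred R (pr_obj P n) N.
  by apply/asboolP=> a u v; rewrite linearP.
apply/asboolP; exists (ModHomOf gL); apply: mod_hom_ext => y.
exact: gE.
Qed.

Lemma pr_diffK n x : pr_diff P n (pr_diff P n.+1 x) = 0.
Proof. by apply/pr_exactS; exists x. Qed.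

Section ShortExact.
Variables (U V : lmodType R) (phi : {linear U -> V}).
Hypothesis phi_surj : forall v, exists u, phi u = v.

(** Half-exactness of Ext in its second argument. *)
Lemma ext_vanishes_extension n :
  ext_vanishes n (kernel phi) -> ext_vanishes n V -> ext_vanishes n U.
Proof.
move=> EK EV f fd.
have [|g gE] := EV (phi \o f : {linear _ -> _}).
  by move=> x /=; rewrite fd linear0.
have [g' g'E] := @pr_projective _ _ P n _ _ phi g phi_surj.
pose k : {linear pr_obj P n.+1 -> U} := f \- (g' \o pr_diff P n).
have kK u : phi (k u) = 0.
  by rewrite /k /= linearB /= g'E gE /= subrr.
have [k' k'E] := corestrict_kernel kK.
have [|h hE] := EK k'.
  move=> x; apply: val_inj; rewrite /= k'E /k /= fd pr_diffK linear0 subr0 //.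
exists (g' \+ (val \o h : {linear _ -> _})) => x /=.
by rewrite hE k'E /k /= addrC subrK.
Qed.

(** The connecting map from degree [n.+1] with values in the quotient to
    degree [n.+2] with values in the kernel is injective when the middle term
    has no Ext in degree [n.+1]. *)
Lemma ext_vanishes_shift n :
  ext_vanishes n U -> ext_vanishes n.+1 (kernel phi) -> ext_vanishes n V.
Proof.
move=> EU EK f fd.
have [f' f'E] := @pr_projective _ _ P n.+1 _ _ phi f phi_surj.
have f'K x : phi ((f' \o pr_diff P n.+1 : {linear _ -> _}) x) = 0.
  by rewrite /= f'E fd.
have [k kE] := corestrict_kernel f'K.
have [|g gE] := EK k.
  by move=> x; apply: val_inj; rewrite /= kE /= pr_diffK linear0.
have [|h hE] := EU (f' \- (val \o g : {linear _ -> _})).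
  by move=> x /=; rewrite gE kE /= subrr.
exists (phi \o h : {linear _ -> _}) => x /=.
by rewrite hE /= linearB /= kernelP subr0 f'E.
Qed.

End ShortExact.
End VanishingExt.

(** * Equivariant maps between modules over a group algebra *)

Section Monomials.
Variables (K : fieldType) (gT : finGroupType).
Local Notation KG := (group_algebra K gT).

Definition mono (c : K) (g : gT) : KG := [ffun h => c *+ (h == g)].

Lemma monoM c d g h : mono c g * mono d h = mono (c * d) (g * h)%g.
Proof.
apply/ffunP=> k; rewrite !ffunE (bigD1 g) //= !ffunE eqxx mulr1n.
rewrite big1 ?addr0 => [|l /negbTE lg]; last by rewrite !ffunE lg mul0r.
by rewrite -mulrnAr (can2_eq (mulKVg g) (mulKg g)).
Qed.

Lemma mono1 : mono 1 1%g = 1 :> KG.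
Proof. by apply/ffunP=> h; rewrite !ffunE. Qed.

Lemma mono0 g : mono 0 g = 0.
Proof. by apply/ffunP=> h; rewrite !ffunE mul0rn. Qed.

Lemma monoD c d g : mono (c + d) g = mono c g + mono d g.
Proof. by apply/ffunP=> h; rewrite !ffunE mulrnDl. Qed.

Lemma monoN1 : mono (-1) 1%g = -1.
Proof. by apply/eqP; rewrite -addr_eq0 -mono1 -monoD addNr mono0. Qed.

Lemma gralg_monoE (a : KG) : a = \sum_g mono (a g) g.
Proof.
apply/ffunP=> h; rewrite sum_ffunE (bigD1 h) //= ffunE eqxx mulr1n.
by rewrite big1 ?addr0 // => g /negbTE gh; rewrite ffunE eq_sym gh.
Qed.

Lemma gralg_natr n : n%:R = mono n%:R 1%g :> KG.
Proof.
by elim: n => [|n IHn]; rewrite ?mono0 // !mulrS IHn monoD mono1.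
Qed.

End Monomials.

Section Equivariant.
Variables (K : fieldType) (gT : finGroupType).
Local Notation KG := (group_algebra K gT).
Local Notation mono := (@mono K gT).
Implicit Types (U V : lmodType KG) (A H : {group gT}).

(** Linearity over the group algebra of [A]; for the trivial group this is
    linearity over [K], so that one definition covers the restrictions of a
    module to all subgroups without changing its type. *)
Definition equivariant A U V (mu : U -> V) : Prop :=
  forall c g u v, g \in A -> mu (mono c g *: u + v) = mono c g *: mu u + mu v.

Section Theory.
Variables (A : {group gT}) (U V : lmodType KG) (mu : U -> V).
Hypothesis muA : equivariant A mu.

Lemma equivariantD u v : mu (u + v) = mu u + mu v.
Proof. by have := muA 1 u v (group1 A); rewrite mono1 !scale1r. Qed.

Lemma equivariant0 : mu 0 = 0.
Proof. by apply/(addrI (mu 0)); rewrite -equivariantD !addr0. Qed.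

Lemma equivariant_sum (I : Type) (r : seq I) (Q : pred I) (F : I -> U) :
  mu (\sum_(i <- r | Q i) F i) = \sum_(i <- r | Q i) mu (F i).
Proof. exact: (big_morph mu equivariantD equivariant0). Qed.

Lemma equivariantZ c g u : g \in A -> mu (mono c g *: u) = mono c g *: mu u.
Proof. by move=> gA; have := muA c u 0 gA; rewrite equivariant0 !addr0. Qed.

Lemma equivariant_supp (a : KG) u :
  {in [predC A], forall g, a g = 0} -> mu (a *: u) = a *: mu u.
Proof.
move=> aA; rewrite [in LHS](gralg_monoE a) [in RHS](gralg_monoE a) !scaler_suml.
rewrite equivariant_sum; apply: eq_bigr => g _.
case gA: (g \in A); first exact: equivariantZ.
by rewrite aA ?inE ?gA // mono0 !scale0r equivariant0.
Qed.

Lemma equivariant_sub H : H \subset A -> equivariant H mu.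
Proof. by move=> HA c g u v gH; apply: muA; apply: (fintype.subsetP HA). Qed.

End Theory.

Lemma equivariant_linear U V (mu : U -> V) : equivariant [set: gT] mu -> linear mu.
Proof.
move=> muG a u v; rewrite (equivariantD muG) (equivariant_supp muG) //.
by move=> g; rewrite !inE.
Qed.

Lemma equivariantP A U V (mu : U -> V) :
    equivariant 1 mu ->
    (forall g u, g \in A -> mu (mono 1 g *: u) = mono 1 g *: mu u) ->
  equivariant A mu.
Proof.
move=> mu1 muA c g u v gA; rewrite (equivariantD mu1); congr (_ + _).
have -> : mono c g = mono c 1%g * mono 1 g by rewrite monoM mulr1 mul1g.
by rewrite -!scalerA (equivariantZ mu1) ?group1 // muA.
Qed.

(** Left without a division by the order of [A], which may be zero in [K] when this
    sum serves to prove the group algebra injective. *)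
Definition conj_sum A U V (mu : U -> V) (u : U) : V :=
  \sum_(g in A) mono 1 g *: mu (mono 1 g^-1%g *: u).

Lemma conj_sum_equivariant A U V (mu : U -> V) :
  equivariant 1 mu -> equivariant A (conj_sum A mu).
Proof.
move=> mu1; apply: equivariantP => [c h u v /set1P-> | h u hA].
  rewrite /conj_sum scaler_sumr -big_split /=; apply: eq_bigr => g _.
  rewrite scalerDr scalerA monoM mul1r mulg1 -{1}[g^-1%g]mul1g -{1}[c]mulr1.
  rewrite -monoM -scalerA mu1 ?group1 // scalerDr !scalerA !monoM.
  by rewrite !mul1r !mulr1 mul1g mulg1.
rewrite /conj_sum scaler_sumr (reindex_inj (mulgI h)) /=.
apply: eq_big => [g|g _]; first by rewrite groupMl.
by rewrite !scalerA !monoM !mul1r invMg mulgKV.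
Qed.

(** A partially defined map is given by its graph, so that domains need not be
    turned into types; the graph is a subspace stable under [A]. *)
Definition partial_map A U V (Gam : set (U * V)) : Prop :=
  [/\ Gam 0,
      forall c g x y, g \in A -> Gam x -> Gam y -> Gam (mono c g *: x + y) &
      forall v, Gam (0, v) -> v = 0].

Definition extends U V (mu : U -> V) (Gam : set (U * V)) : Prop :=
  (forall u v, Gam (u, v) -> mu u = v) /\ (forall u, exists u', Gam (u', mu u)).

Lemma partial_map_fun A U V (Gam : set (U * V)) u v w :
  partial_map A Gam -> Gam (u, v) -> Gam (u, w) -> v = w.
Proof.
case=> _ GamZ Gam0 Gv Gw; apply/subr0_eq/Gam0.
have := GamZ (-1) 1%g _ _ (group1 A) Gw Gv.
by rewrite monoN1 scaleN1r addrC; congr Gam; congr pair; rewrite /= subrr.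
Qed.

(** Zorn's lemma, applied to the graphs with the same range: a map defined on
    too small a domain can be extended by zero on a further vector. Keeping the
    range makes an extension of the identity of a subspace a projection onto
    it. *)
Lemma linear_extension U V (Gam : set (U * V)) :
  partial_map 1 Gam -> exists2 mu, equivariant 1 mu & extends mu Gam.
Proof.
move=> GamP.
pose good (X : set (U * V)) := partial_map 1 X /\ forall x, X x -> exists u, Gam (u, x.2).
have good0 : good (Gam `|` set0)%classic.
  by rewrite setU0; split=> // -[u v] Guv; exists u.
have [F FP Ftot | D [[DP Drng] Dmax]] :=
    @Zorn_bigcup (U * V)%type (fun X => good (Gam `|` X)%classic).
  pose GF := (Gam `|` \bigcup_(X in F) X)%classic.
  have GF1 x : GF x -> exists2 X, F X \/ X = set0 & (Gam `|` X)%classic x.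
    case=> [Gx|[X FX Xx]]; first by exists set0; [right | left].
    by exists X; [left | right].
  have subGF X x : F X \/ X = set0 -> (Gam `|` X)%classic x -> GF x.
    case=> [FX [Gx|Xx]|-> [Gx|[]]]; [by left| |by left].
    by right; exists X.
  have goodX X : F X \/ X = set0 -> good (Gam `|` X)%classic.
    by case=> [/FP|->].
  have GF2 x y : GF x -> GF y ->
      exists2 X, F X \/ X = set0 & (Gam `|` X)%classic x /\ (Gam `|` X)%classic y.
    move=> /GF1[X [FX|->] Xx] /GF1[Y [FY|->] Yy]; last 1 first.
    - by exists set0; [right |].
    - have [XY|YX] := Ftot _ _ FX FY.
        by exists Y; [left | split=> //; case: Xx => [|/XY]; [left | right]].
      by exists X; [left | split=> //; case: Yy => [|/YX]; [left | right]].
    - by exists X; [left | split=> //; case: Yy => [|[]]; left].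
    - by exists Y; [left | split=> //; case: Xx => [|[]]; left].
  split; last by move=> x /GF1[X /goodX[_ Xr] /Xr].
  split; first by left; case: GamP.
    move=> c g x y g1 /GF2 xG /xG[X FX [Xx Xy]]; apply: (subGF X) => //.
    by have [[_ XZ _] _] := goodX X FX; apply: XZ.
  by move=> v /GF1[X /goodX[[_ _ X0] _] /X0].
set E := (Gam `|` D)%classic in DP Drng Dmax.
have [E0 EZ Efun] := DP.
have Edom u : exists v, E (u, v).
  apply: contrapT => /forallNP Eu.
  (* the graph extended by zero on the line spanned by u *)
  pose D' := [set x : U * V | exists a y, E y /\ x = (mono a 1%g *: u + y.1, y.2)]%classic.
  have ED' x : E x -> D' x.
    move=> Ex; exists 0, x; split=> //; case: x {Ex} => x y /=; congr pair.
    by rewrite mono0 scale0r add0r.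
  have GD' : (Gam `|` D')%classic = D'.
    by apply/seteqP; split=> [x [Gx|//]|x]; [apply: ED'; left | right].
  apply: (Dmax D'); last rewrite GD'.
    split; first by move=> x Dx; apply: ED'; right.
    move=> D'D; apply: (Eu 0); right; apply: D'D; exists 1, 0; split=> //.
    by rewrite mono1 scale1r addr0.
  split; last by move=> x [a [y [/Drng[w Gw] ->]]]; exists w.
  split; first exact: ED'.
    move=> c g _ _ /[dup] g1 /set1P-> [a [y [Ey ->]]] [b [z [Ez ->]]].
    exists (c * a + b), (mono c 1%g *: y + z); split; first exact: EZ.
    congr pair => /=.
    by rewrite monoD scalerDl scalerDr scalerA monoM mul1g addrACA.
  move=> v [a [y [Ey [uE vE]]]].
  (* a nonzero multiple of u cannot lie in the domain of the old graph *)
  have [a0|a_neq0] := eqVneq a 0.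
    apply: Efun; rewrite vE uE a0 mono0 scale0r add0r.
    by case: y Ey {uE vE}.
  case: (Eu ((mono (- a^-1) 1%g *: y).2)).
  have := EZ (- a^-1) 1%g _ _ (group1 _) Ey E0.
  rewrite addr0; congr E; rewrite [LHS]surjective_pairing; congr pair => /=.
  have -> : y.1 = - (mono a 1%g *: u) by apply/eqP; rewrite eq_sym eqr_oppLR -addr_eq0 -uE.
  rewrite scalerN scalerA monoM mulNr mulVf // mul1g -scaleNr.
  by rewrite monoN1 opprK scale1r.
have [mu muE] := choice Edom.
have muP u v : E (u, v) -> mu u = v by exact: (partial_map_fun DP (muE u)).
exists mu.
  by move=> c g u v g1; apply/muP/(EZ c g (u, mu u) (v, mu v)).
by split=> [u v Guv | u]; [apply: muP; left | apply: (Drng (u, mu u))].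
Qed.

(** Maschke's theorem: a [K]-linear extension is averaged over [H]. *)
Lemma equivariant_extension H U V (Gam : set (U * V)) :
    (#|H|%:R != 0 :> K) -> partial_map H Gam ->
  exists2 mu, equivariant H mu & extends mu Gam.
Proof.
move=> H0 GamP; have [Gam0 GamZ Gamf] := GamP.
have [|mu mu1 [muE muR]] := @linear_extension U V Gam.
  by split=> // c g x y /set1P->; apply: GamZ.
have GZ c g x : g \in H -> Gam x -> Gam (mono c g *: x).
  by move=> gH Gx; rewrite -[_ *: x]addr0; apply: GamZ.
have GS (F : gT -> U * V) : (forall g, g \in H -> Gam (F g)) ->
    Gam (\sum_(g in H) F g).
  move=> GF; apply: big_ind => // x y Gx Gy.
  by rewrite -[x]scale1r -mono1; apply: GamZ.
pose nu u := mono (#|H|%:R^-1) 1%g *: conj_sum H mu u.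
have comm1 c g : mono c 1%g * mono 1 g = mono 1 g * mono c 1%g.
  by rewrite !monoM mulrC mul1g mulg1.
exists nu.
  have csH := conj_sum_equivariant (A := H) mu1.
  apply: equivariantP => [c h u v /set1P->|h u hH]; rewrite /nu.
    rewrite csH // scalerDr !scalerA !monoM mulrC //.
  by rewrite (equivariantZ csH) // !scalerA comm1.
split=> [u v Guv | u]; last first.
  have /choice[w wP] g : exists w, Gam (w, mu (mono 1 g^-1%g *: u)).
    exact: muR.
  exists (mono (#|H|%:R^-1) 1%g *: \sum_(g in H) mono 1 g *: (w g, mu (mono 1 g^-1%g *: u))).1.
  have := GZ (#|H|%:R^-1) 1%g _ (group1 H) (GS _ (fun g gH => GZ 1 g _ gH (wP g))).
  congr Gam; rewrite [LHS]surjective_pairing; congr pair => //=.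
  by congr (_ *: _); rewrite raddf_sum.
rewrite /nu /conj_sum (eq_bigr (fun=> v)) => [|g gH]; last first.
  rewrite (muE _ (mono 1 g^-1%g *: v)); last by apply: (GZ 1 g^-1%g (u, v)); rewrite ?groupV.
  by rewrite scalerA monoM mulgV mulr1 mono1 scale1r.
rewrite sumr_const -scaler_nat scalerA gralg_natr monoM mulg1 mulVf //.
by rewrite mono1 scale1r.
Qed.

End Equivariant.

(** * Fixed points of p-groups in characteristic p *)

Section FixedPoint.
Variables (p : nat) (gT : finGroupType) (M : zmodType) (to : gT -> M -> M).
Hypothesis p_prime : prime p.
Hypothesis Mp : forall m : M, m *+ p = 0.
Hypothesis toB : forall g, {morph to g : m n / m - n}.
Hypothesis to1 : forall m, to 1%g m = m.
Hypothesis toM : forall g h m, to (g * h)%g m = to g (to h m).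

Let D g m : M := to g m - m.

Let to0 g : to g 0 = 0.
Proof. by rewrite -[0 in LHS](subrr 0) toB subrr. Qed.

Let toD g : {morph to g : m n / m + n}.
Proof.
by move=> m n; rewrite -{1}[n]opprK -(sub0r n) !toB to0 sub0r opprK.
Qed.

Let toMn g m k : to g (m *+ k) = to g m *+ k.
Proof. by elim: k => [|k IHk]; rewrite ?mulr0n ?to0 // !mulrS toD IHk. Qed.

Lemma to_exp g k m : to (g ^+ k)%g m = iter k (to g) m.
Proof. by elim: k => [|k IHk]; rewrite ?expg0 ?to1 // expgS toM IHk. Qed.

(** The binomial expansion of powers of [g = 1 + D g]; written in this
    direction it has no signs. *)
Lemma to_exp_binomial g k m :
  to (g ^+ k)%g m = \sum_(i < k.+1) iter i (D g) m *+ 'C(k, i).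
Proof.
rewrite to_exp; elim: k => [|k IHk].
  by rewrite big_ord1 bin0 mulr1n.
have toE n : to g n = n + D g n by rewrite addrC subrK.
rewrite iterS IHk (big_morph (to g) (toD g) (to0 g)).
under eq_bigr => i _ do rewrite toMn toE mulrnDl -iterS.
rewrite big_split /= [RHS]big_ord_recl [in X in X + _ = _]big_ord_recl /= !bin0.
rewrite -addrA; congr (_ + _).
under [RHS]eq_bigr => i _ do rewrite /bump /= add1n binS mulrnDr.
rewrite big_split /=; congr (_ + _).
by rewrite big_ord_recr /= bin_small // mulr0n addr0.
Qed.

Lemma iterD_prime g m : iter p (D g) m = D (g ^+ p)%g m.
Proof.
rewrite {2}/D to_exp_binomial.
have p_gt0 := prime_gt0 p_prime.
(* only the two extreme binomial coefficients survive modulo p *)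
pose F i := iter i (D g) m *+ 'C(p, i).
rewrite -(big_mkord xpredT F) -[in \sum_(0 <= i < _) _](prednK p_gt0).
rewrite big_nat_recl // big_nat_recr //= prednK // {1 3}/F bin0 binn.
rewrite big_nat_cond big1 ?add0r => [|i /andP[/andP[_ ip] _]].
  by rewrite mulr1n addrC addKr.
have /dvdnP[q pE] : (p %| 'C(p, i.+1))%N.
  by apply: prime_dvd_bin => //=; rewrite -ltn_predRL.
by rewrite /F pE mulnC mulrnA Mp mul0rn.
Qed.

Lemma iterD_prime_exp g k m : iter (p ^ k) (D g) m = D (g ^+ (p ^ k))%g m.
Proof.
elim: k g m => [|k IHk] g m; first by rewrite expn0 expg1.
rewrite expnS expgM -IHk mulnC.
elim: (p ^ k)%N => // j IHj.
by rewrite mulSn iterD IHj iterD_prime.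
Qed.

(** A subgroup [Q] that is proper in [P] is proper in its normaliser; for [g] in
    this normaliser, [D g] is nilpotent on the vectors fixed by [Q], so it kills
    a nonzero one. *)
Lemma pgroup_fixed_point (P : {group gT}) (Phi : M -> Prop) :
    (p.-group P)%g ->
    (forall m n, Phi m -> Phi n -> Phi (m - n)) ->
    (forall g m, Phi m -> Phi (to g m)) ->
    (exists2 m, m != 0 & Phi m) ->
  exists m, [/\ m != 0, Phi m & {in P, forall g, to g m = m}].
Proof.
move=> pP PhiB Phito [m0 m0_neq0 Phim0].
pose fixes (Q : {group gT}) :=
  exists m, [/\ m != 0, Phi m & {in Q, forall g, to g m = m}].
suff fixP k (Q : {group gT}) : (#|P| - #|Q| < k)%N -> Q \subset P -> fixes Q -> fixes P.
  apply: (fixP _ 1%G (ltnSn _)); first exact: sub1G.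
  by exists m0; split=> // g /set1P->.
elim: k Q => // k IHk Q ltk sQP [m [m_neq0 Phim mQ]].
have [PQ|nPQ] := boolP (P \subset Q).
  by exists m; split=> // g gP; apply: mQ; apply: (fintype.subsetP PQ).
have propQ : Q \proper P by rewrite properE sQP nPQ.
have /properP[_ [x]] := nilpotent_proper_norm (pgroup_nil pP) propQ.
rewrite inE => /andP[xP xN] xQ.
have ex_j : exists j, iter j (D x) m == 0.
  have [e Pe] := p_natP pP; exists (p ^ e)%N.
  by rewrite iterD_prime_exp /D -Pe expg_cardG // to1 subrr.
(* the last nonzero iterate of D x is fixed by x *)
case: (ex_minnP ex_j) => -[|j] /eqP Dj minj; first by case/eqP: m_neq0.
have DP i : Phi (iter i (D x) m) /\ {in Q, forall g, to g (iter i (D x) m) = iter i (D x) m}.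
  elim: i => [|i [Phii Qi]] //=; split; first by apply: PhiB; first exact: Phito.
  move=> g gQ; set v := iter i _ _ in Phii Qi *.
  rewrite /D toB (Qi g gQ) -toM.
  have -> : (g * x = x * (g ^ x))%g by rewrite conjgE mulKVg.
  by rewrite toM Qi // memJ_norm.
have [Phij Qj] := DP j.
have xj : to x (iter j (D x) m) = iter j (D x) m by apply/subr0_eq.
apply: (IHk (Q <*> <[x]>)%G).
- apply: leq_trans (_ : #|P| - #|Q| <= k)%N => //.
  apply: ltn_sub2l; first exact: proper_card.
  apply: proper_card; rewrite properE joing_subl /=; apply/subsetPn; exists x => //.
  by rewrite (fintype.subsetP (joing_subr _ _)) // cycle_id.
- by rewrite join_subG sQP cycle_subG.
exists (iter j (D x) m); split=> //.
  by apply/negP=> /minj; rewrite ltnn.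
move=> g /=; rewrite norm_joinEr ?cycle_subG // => /mulsgP[a _ aQ /cycleP[i ->] ->].
rewrite toM to_exp (_ : iter i _ _ = iter j (D x) m) ?Qj //.
by elim: i => // i IHi; rewrite iterS IHi.
Qed.

End FixedPoint.

(** * Injectivity and idempotents of group algebras *)

Section GroupAlgebraIdeals.
Variables (K : fieldType) (gT : finGroupType).
Local Notation KG := (group_algebra K gT).
Local Notation mono := (@mono K gT).
Implicit Types (A H : {group gT}) (a b : KG).

Definition supported A a : Prop := {in [predC A], forall g, a g = 0}.

Lemma mono_mulE c g a h : (mono c g * a) h = c * a (g^-1 * h)%g.
Proof.
rewrite ffunE (bigD1 g) //= !ffunE eqxx mulr1n big1 ?addr0 // => k /negbTE kg.
by rewrite !ffunE kg mulr0n mul0r.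
Qed.

Lemma mono_scalarC c (a : KG) : a * mono c 1%g = mono c 1%g * a.
Proof.
rewrite [a in LHS]gralg_monoE [a in RHS]gralg_monoE mulr_suml mulr_sumr.
by apply: eq_bigr => g _; rewrite !monoM mulrC mulg1 mul1g.
Qed.

Lemma supported_monoD A c g a b :
  g \in A -> supported A a -> supported A b -> supported A (mono c g * a + b).
Proof.
move=> gA aA bA h hA; rewrite ffunE mono_mulE bA // aA ?mulr0 ?addr0 //.
by move: hA; rewrite !inE groupMl ?groupV.
Qed.

Lemma supported0 A : supported A 0.
Proof. by move=> g _; rewrite ffunE. Qed.

Lemma supported1 A : supported A 1.
Proof.
move=> g; rewrite !inE ffunE => /negP gA.
by case: eqP gA => // ->; rewrite group1.
Qed.

Lemma supportedB A a b : supported A a -> supported A b -> supported A (a - b).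
Proof. by move=> aA bA g gA; rewrite !ffunE aA // bA // subrr. Qed.

(** A [K]-linear extension exists because [K] is a field; composing it with the
    coefficient at the identity and spreading the result over the group makes
    it linear over the group algebra. *)
Lemma ext_vanishes_regular (M : lmodType KG) (P : projective_resolution M) n :
  ext_vanishes P n KG^o.
Proof.
move=> f fd.
have scaleE a b : a *: (b : KG^o) = a * b by [].
pose Gam := [set y : pr_obj P n * KG^o | exists x, y = (pr_diff P n x, f x)]%classic.
have [|mu mu1 [muE _]] := @linear_extension K gT _ _ Gam.
  split; first by exists 0; rewrite !linear0.
    move=> c g _ _ _ [x ->] [y ->]; exists (mono c g *: x + y).
    by rewrite !linearP.
  move=> v [x [/esym dx ->]].
  by have /pr_exactS[y <-] := dx; apply: fd.
pose coef1 u : KG^o := mono (mu u 1%g) 1%g.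
have coef1P : equivariant 1 coef1.
  move=> c g u v /[dup] g1 /set1P->; rewrite /coef1 mu1 ?group1 // !scaleE.
  rewrite monoM mulg1 ffunE mono_mulE invg1 mulg1.
  by rewrite monoD.
have [h hE] := pack_linear (equivariant_linear (conj_sum_equivariant (A := [set: gT]) coef1P)).
exists h => x; rewrite hE /conj_sum [RHS]gralg_monoE.
apply: eq_big => [g|g _]; first by rewrite inE.
rewrite /coef1 (muE _ (mono 1 g^-1%g *: f x)); last first.
  by exists (mono 1 g^-1%g *: x); rewrite !linearZ.
by rewrite !scaleE monoM mulg1 mul1r mono_mulE mul1r invgK mulg1.
Qed.

(** The identity is the image of 1 under a [KH]-linear retraction onto the
    ideal. *)
Lemma left_ideal_right_identity H (J : KG -> Prop) :
    #|H|%:R != 0 :> K ->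
    J 0 ->
    (forall c g a b, g \in H -> J a -> J b -> J (mono c g * a + b)) ->
    (forall a, J a -> supported H a) ->
  exists2 e, J e & forall a, J a -> a * e = a.
Proof.
move=> H0 J0 JZ JH.
pose Gam := [set y : KG^o * KG^o | J y.1 /\ y.2 = y.1]%classic.
have [|mu muH [muE muR]] := @equivariant_extension K gT H _ _ Gam H0.
  split=> [|c g [a _] [b _] gH [/= Ja ->] [/= Jb ->]|v [_]] //=.
  by split=> //; apply: JZ.
exists (mu 1) => [|a Ja]; first by have [e [/= Je ->]] := muR 1.
transitivity (mu (a * 1)); last by apply: muE; rewrite mulr1.
exact/esym/(equivariant_supp muH (1 : KG^o) (JH a Ja)).
Qed.

End GroupAlgebraIdeals.

(** * Finite dimension *)

Section Dimension.
Variables (K : fieldType) (gT : finGroupType).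
Local Notation KG := (group_algebra K gT).
Local Notation mono := (@mono K gT).

(** Dimension over [K] less than [d], without choosing bases. *)
Definition dim_lt d (U : lmodType KG) : Prop :=
  forall v : 'I_d -> U, exists2 c : 'I_d -> K,
    exists i, c i != 0 & \sum_i mono (c i) 1%g *: v i = 0.

Lemma dim_lt_regular : dim_lt #|gT|.+1 KG^o.
Proof.
move=> v; pose A := \matrix_(i < #|gT|.+1, j < #|gT|) v i (enum_val j).
have /negbTE nfA : ~~ row_free A.
  by rewrite /row_free neq_ltn ltnS rank_leq_col.
pose r := nz_row (kermx A).
have /rV0Pn[i ri] : r != 0 by rewrite nz_row_eq0 kermx_eq0 nfA.
exists (fun i => r 0 i); first by exists i.
apply/ffunP=> g; rewrite sum_ffunE [RHS]ffunE.
have /sub_kermxP/matrixP/(_ 0 (enum_rank g)) := nz_row_sub (kermx A).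
rewrite !mxE => rA; rewrite -[RHS]rA; apply: eq_bigr => j _.
by rewrite -[mono _ _ *: v j]/(mono _ _ * v j) mono_mulE mxE enum_rankK invg1 mul1g.
Qed.

Lemma dim_lt_kernel d (U V : lmodType KG) (f : {linear U -> V}) :
  dim_lt d U -> dim_lt d (kernel f).
Proof.
move=> dU v; have [c c0 cv] := dU (fun i => val (v i)).
by exists c => //; apply: val_inj; rewrite raddf_sum.
Qed.

Lemma dim_lt_kernelS d (U V : lmodType KG) (f : {linear U -> V}) u :
  f u != 0 -> dim_lt d.+1 U -> dim_lt d (kernel f).
Proof.
move=> fu dU v.
have [c [i ci] cv] := dU (fun i => if unlift ord0 i is Some j then val (v j) else u).
rewrite big_ord_recl unlift_none in cv.
rewrite (eq_bigr (fun j => mono (c (lift ord0 j)) 1%g *: val (v j))) in cv; last first.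
  by move=> j _; rewrite liftK.
(* applying f kills all terms but the multiple of f u *)
have c0 : c ord0 = 0.
  apply: contraTeq fu => c0; rewrite negbK.
  have /(congr1 (fun x => mono (c ord0)^-1 1%g *: f x)) := cv.
  rewrite linear0 scaler0 linearD linearZ linear_sum big1 => [|j _]; last first.
    by rewrite linearZ /= kernelP scaler0.
  by rewrite addr0 scalerA monoM mulVf // mulg1 mono1 scale1r => ->.
exists (fun j => c (lift ord0 j)).
  by case: (unliftP ord0 i) ci => [j ->|->]; [exists j | rewrite c0 eqxx].
apply: val_inj; by rewrite raddf_sum /= -[RHS]cv c0 mono0 scale0r add0r.
Qed.

End Dimension.

(** * Modules in the block of a simple module *)

Section Block.
Variables (p : nat) (K : fieldType) (gT : finGroupType) (H Q : {group gT}).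
Hypothesis pcharK : p \in [pchar K].
Hypothesis nHG : (H <| [set: gT])%g.
Hypothesis coHp : coprime #|H| p.
Hypothesis pQ : (p.-group Q)%g.
Hypothesis HQ : (H * Q)%g = [set: gT].

Local Notation KG := (group_algebra K gT).
Local Notation mono := (@mono K gT).

Variable S : lmodType KG.
Hypothesis simpleS : simple_module S.

Lemma card_complement_neq0 : #|H|%:R != 0 :> K.
Proof.
rewrite -(dvdn_pcharf pcharK); apply: contraTN coHp => pH.
by rewrite coprime_sym prime_coprime ?negbK // (pcharf_prime pcharK).
Qed.

Lemma module_pchar (U : lmodType KG) (u : U) : u *+ p = 0.
Proof.
by rewrite -scaler_nat gralg_natr (pcharf0 pcharK) mono0 scale0r.
Qed.

Lemma onto_simple (U : lmodType KG) (f : {linear U -> S}) u :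
  f u != 0 -> forall s, exists v, f v = s.
Proof.
move=> fu s; pose im : {pred S} := fun t => `[< exists v, f v = t >].
have [|f0|fT] := simpleS.2 im; last by apply/asboolP/fT.
  split=> [|a x y /asboolP[v <-] /asboolP[w <-]]; apply/asboolP.
    by exists 0; rewrite linear0.
  by exists (a *: v + w); rewrite linearP.
by case/eqP: fu; apply: f0; apply/asboolP; exists u.
Qed.

Definition annihilator (a : KG) : Prop := supported H a /\ forall s : S, a *: s = 0.

(** Membership in the block of [S], expressed through [H]: the blocks of the
    group correspond to the orbits of simple modules of the normal
    [p]-complement [H]. *)
Definition in_block (U : lmodType KG) : Prop :=
  forall a, annihilator a -> forall u : U, a *: u = 0.

Lemma in_block_kernel (U V : lmodType KG) (f : {linear U -> V}) :
  in_block U -> in_block (kernel f).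
Proof. by move=> bU a Ia u; apply: val_inj; apply: bU. Qed.

Lemma annihilator_left_ideal c g a b : g \in H ->
  annihilator a -> annihilator b -> annihilator (mono c g * a + b).
Proof.
move=> gH [aH a0] [bH b0]; split=> [|s]; first exact: supported_monoD.
by rewrite scalerDl -scalerA a0 b0 scaler0 addr0.
Qed.

(** Conjugation by [g] preserves [KH], as [H] is normal, and the annihilator of
    [S], as [S] is a module for the whole group. *)
Lemma annihilatorJ a g : annihilator a -> annihilator (mono 1 g^-1%g * a * mono 1 g).
Proof.
case=> aH a0; split=> [h hH|s]; last by rewrite -!scalerA a0 scaler0.
rewrite ffunE big1 // => k _; rewrite mono_mulE ffunE mul1r invgK.
case: eqP => [kE|_]; last by rewrite mulr0.
have hE : h = ((g * k) ^ g)%g by rewrite conjgE -mulgA mulKg -kE mulKVg.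
rewrite aH ?mul0r //; move: hH; rewrite !inE {1}hE memJ_norm //.
by rewrite (fintype.subsetP (normal_norm nHG)) // inE.
Qed.

(** A vector [u] whose annihilator in [KH] is generated by the idempotent [e]
    generates a copy of [KH (1 - e)]; this meets [S] nontrivially since
    otherwise [1 - e] would annihilate [S] and hence [u]. *)
Lemma block_KH_map (U : lmodType KG) (u : U) : in_block U -> u != 0 ->
  exists2 mu : U -> S, equivariant H mu & mu u != 0.
Proof.
move=> bU u0.
have [||a|e [eH eu] eP] := @left_ideal_right_identity K gT H
    (fun a => supported H a /\ a *: u = 0) card_complement_neq0.
- by split; [exact: supported0 | rewrite scale0r].
- move=> c g a b gH [aH a0] [bH b0]; split; first exact: supported_monoD.
  by rewrite scalerDl -scalerA a0 b0 scaler0 addr0.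
- by case.
have [s s0] : exists s : S, (1 - e) *: s != 0.
  apply: contrapT => /forallNP e1; case/eqP: u0.
  rewrite -[u]scale1r -[1](subrK e) scalerDl eu addr0; apply: bU.
  by split=> [|s]; [apply: supportedB (@supported1 _ _ H) eH | apply/eqP/negPn/negP/e1].
pose Gam := [set y : U * S | exists2 a, supported H a &
  y = (a *: u, a *: ((1 - e) *: s))]%classic.
have [|mu muH [muE _]] := @equivariant_extension K gT H _ _ Gam card_complement_neq0.
  split; first by exists 0; rewrite ?scale0r //; apply: supported0.
    move=> c g _ _ gH [a aH ->] [b bH ->]; exists (mono c g * a + b).
      exact: supported_monoD.
    rewrite [LHS]surjective_pairing.
    by congr pair; rewrite /= !scalerDl -!scalerA.
  move=> v [a aH [/esym au ->]].
  by rewrite scalerA mulrBr mulr1 (eP a) // subrr scale0r.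
exists mu => //; rewrite (muE _ ((1 - e) *: s)) //.
by exists 1; rewrite ?scale1r //; apply: supported1.
Qed.

(** Among the [KH]-linear maps, those fixed under conjugation by [Q] are
    [KG]-linear. *)
Lemma block_map (U : lmodType KG) (u : U) : in_block U -> u != 0 ->
  exists (f : {linear U -> S}) v, f v != 0.
Proof.
move=> bU u0; have [mu muH muu] := block_KH_map bU u0.
pose M : zmodType := (U -> S).
pose to g (nu : M) : M := fun v => mono 1 g *: nu (mono 1 g^-1%g *: v).
have funB (f h : M) v : (f - h) v = f v - h v by [].
have [||||||||nu [nu0 nuH nuQ]] := @pgroup_fixed_point p gT M to _ _ _ _ _ Q
    (equivariant (U := U) (V := S) H) pQ.
- exact: pcharf_prime pcharK.
- move=> nu; apply/funext=> v.
  have E k : (nu *+ k) v = nu v *+ k by elim: k => // k IHk; rewrite !mulrS -IHk.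
  by rewrite E module_pchar.
- by move=> g f h; apply/funext=> v; rewrite funB /to funB scalerBr.
- by move=> f; apply/funext=> v; rewrite /to invg1 mono1 !scale1r.
- move=> g h f; apply/funext=> v.
  by rewrite /to !scalerA !monoM !mulr1 invMg.
- move=> f h fH hH c g v w gH; rewrite !funB fH // hH //.
  by rewrite opprD addrACA scalerBr.
- move=> g f fH c h v w hH; rewrite /to.
  have hgH : (h ^ g)%g \in H.
    by rewrite memJ_norm // (fintype.subsetP (normal_norm nHG)) // inE.
  have -> : mono 1 g^-1%g *: (mono c h *: v + w) =
      mono c (h ^ g)%g *: (mono 1 g^-1%g *: v) + mono 1 g^-1%g *: w.
    by rewrite scalerDr !scalerA !monoM mulr1 mul1r conjgE -!mulgA mulgV mulg1.
  rewrite fH // scalerDr !scalerA !monoM mulr1 mul1r.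
  by rewrite conjgE mulKVg.
- by exists mu => //; apply: contra_neq muu => ->.
have nuG : equivariant [set: gT] nu.
  apply: equivariantP => [|g v _]; first exact: (equivariant_sub nuH (sub1G _)).
  have /mulsgP[h q hH qQ ->] : g \in (H * Q)%g by rewrite HQ inE.
  have moE : mono 1 (h * q)%g = mono 1 h * mono 1 q by rewrite monoM mulr1.
  rewrite moE -!scalerA (equivariantZ nuH) //; congr (_ *: _).
  have /(congr1 (fun f => f (mono 1 q *: v))) := nuQ q qQ.
  by rewrite /to scalerA monoM mulVg mulr1 mono1 scale1r.
have [f fE] := pack_linear (equivariant_linear nuG).
exists f; apply: contrapT => /forallNP f0; case/eqP: nu0.
by apply/funext=> v; rewrite -fE; apply/eqP/negPn/negP/f0.
Qed.

(** Every nonzero module in the block maps onto [S], with a kernel in the block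
    of smaller dimension. *)
Lemma ext_vanishes_block (M : lmodType KG) (P : projective_resolution M) n d
    (U : lmodType KG) :
  dim_lt d U -> in_block U -> ext_vanishes P n S -> ext_vanishes P n U.
Proof.
move=> dU bU ES; elim: d U dU bU => [|d IHd] U dU bU.
  by have [c [[]]] := dU (fun=> 0).
have [U0|/existsNP[u /eqP u0]] := pselect (forall u : U, u = 0).
  by move=> f _; exists \0 => x; apply: etrans (U0 _) (esym (U0 _)).
have [f [v fv]] := block_map bU u0.
apply: (ext_vanishes_extension (onto_simple fv)) => //.
by apply: IHd; [apply: dim_lt_kernelS fv dU | apply: in_block_kernel].
Qed.

(** The direct summand [B = KG (1 - e)] of [KG], for a right identity [e] of the
    annihilator of [S] in [KH]. It lies in the block because the annihilator is
    stable under conjugation. *)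
Lemma block_cover : exists (B : lmodType KG) (psi : {linear B -> S}),
  [/\ in_block B, dim_lt #|gT|.+1 B, forall s, exists b, psi b = s &
      forall (M : lmodType KG) (P : projective_resolution M) n, ext_vanishes P n B].
Proof.
have [|||e [eH eS] eP] := @left_ideal_right_identity K gT H annihilator
    card_complement_neq0.
- by split=> [|s]; [exact: supported0 | rewrite scale0r].
- exact: annihilator_left_ideal.
- by move=> a [].
have mulr_linear a : linear (fun x : KG^o => x * a : KG^o).
  by move=> c x y; rewrite mulrDl -scalerAl.
have [rho rhoE] := pack_linear (mulr_linear e).
have [rho' rho'E] := pack_linear (mulr_linear (1 - e)).
have rho'K x : rho (rho' x) = 0.
  by rewrite rhoE rho'E -mulrA mulrBl mul1r eP ?subrr ?mulr0.
have [pi piE] := corestrict_kernel rho'K.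
have [s0 s0_neq0] := simpleS.1.
have lin_s0 : linear (fun b : kernel rho => (kernel_val b : KG) *: s0).
  by move=> c x y; rewrite scalerA -scalerDl.
have [psi psiE] := pack_linear lin_s0.
exists (kernel rho), psi; split.
- move=> a Ia b; apply: val_inj.
  (* e acts as a right identity on the two-sided ideal of KG generated by the
     annihilator, since a * g = g * (g^-1 * a * g) *)
  have axe x : a * x * e = a * x.
    rewrite (gralg_monoE x) mulr_sumr mulr_suml; apply: eq_bigr => g _.
    have -> : a * mono (x g) g = mono (x g) g * (mono 1 g^-1%g * a * mono 1 g).
      rewrite !mulrA monoM mulr1 mulgV -mono_scalarC -mulrA monoM mulr1.
      by rewrite mul1g.
    by rewrite -mulrA eP //; apply: annihilatorJ.
  have := kernelP b; rewrite rhoE => be.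
  by rewrite -[LHS]/(a * kernel_val b) -axe -mulrA be mulr0.
- exact/dim_lt_kernel/dim_lt_regular.
- apply: (@onto_simple _ psi (pi 1)).
  by rewrite psiE piE rho'E mul1r scalerBl scale1r eS subr0.
- move=> M P n f fd.
  have [|g gE] := ext_vanishes_regular (f := (val \o f : {linear _ -> KG^o})).
    by move=> x /=; rewrite fd.
  exists (pi \o g : {linear _ -> _}) => x; apply: val_inj.
  rewrite /= piE rho'E gE /= mulrBr mulr1.
  by have := kernelP (f x); rewrite rhoE => ->; rewrite subr0.
Qed.

(** The kernel of the cover has no Ext one degree higher, being in the block, so
    dimension shifting applies. *)
Lemma ext_vanishes_pred (M : lmodType KG) (P : projective_resolution M) n :
  ext_vanishes P n.+1 S -> ext_vanishes P n S.
Proof.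
move=> ES; have [B [psi [bB dB psi_surj EB]]] := block_cover.
apply: (ext_vanishes_shift psi_surj (EB M P n)).
by apply: ext_vanishes_block (dim_lt_kernel dB) (in_block_kernel bB) ES.
Qed.

End Block.

Theorem proposition2p13 (p : nat) (K : fieldType) (pcharK : p \in [pchar K])
    (gT : finGroupType) (pcompG : has_normal_p_complement p [set: gT])
    (S : lmodType (group_algebra K gT)) (simpleS : simple_module S)
    (Ext1 : exists x : Ext 1 S S, x != 0) (n : nat) (n_gt0 : (0 < n)%N) :
  exists x : Ext n S S, x != 0.
Proof.
have [H [Q [nHG coHp sylQ /sdprodP[_ HQ _ _]]]] := pcompG.
apply: contrapT => /forallNP En.
have {En} : ext_vanishes (free_resolution S) n.-1 S.
  apply/Ext_eq0P; rewrite prednK // => x; exact/eqP/negPn/negP/En.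
have {Ext1} : ~ ext_vanishes (free_resolution S) 0 S.
  by move=> /Ext_eq0P E1; case: Ext1 => x /eqP; apply; apply: E1.
apply: contra_not; elim: n.-1 => // m IHm Em; apply: IHm.
exact: (ext_vanishes_pred pcharK nHG coHp (pHall_pgroup sylQ) HQ simpleS Em).
Qed.
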